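(* Let $G$ be an amenable, compactly generated, locally compact group, and let $\mu$ be a courteous probability measure on $G$. Let $(X_t)_t$ denote the $\mu$-random walk on $G$. Let $f:G\to\mathbb R$ be a continuous function that converges along random walks, and assume that $f$ has sub-exponential growth, that is, $$\limsup_{r\to\infty}\ \tfrac1r \sup_{|x|\le r}\log|f(x)| = 0 .$$ If $\dim\,\mathrm{span}(G.f)<\infty$, then $f$ is constant.
   Context: Let $G$ be a compactly generated locally compact group, and fix a compact symmetric generating set $K=K^{-1}$. Let $|x|=\min\{n : x\in K^n\}$ be the word length with respect to $K$ (with $|1|=0$). A probability measure $\mu$ on $G$ is courteous if it is adapted (there is no proper closed subgroup $H\lneq G$ with $\mu(H)=1$), symmetric ($\mu(A)=\mu(A^{-1})$ for every measurable $A$), and has a third moment ($\int_G |s|^3\,d\mu(s)<\infty$). The $\mu$-random walk is $X_0=1$, $X_t=U_1\cdots U_t$, with $(U_t)_{t\ge1}$ i.i.d. of law $\mu$. A function $f:G\to\mathbb R$ converges along random walks if for every $x\in G$ the sequence $(f(xX_t))_t$ converges almost surely. $G$ acts on functions $f:G\to\mathbb R$ by $(\gamma.f)(x)=f(\gamma^{-1}x)$; $G.f=\{\gamma.f:\gamma\in G\}$ is the orbit of $f$, and $\mathrm{span}(G.f)$ is its real linear span. *)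

(* Defs.v *)
From HB Require Import structures.
From mathcomp Require Import all_boot all_order all_algebra finmap.
From mathcomp Require Import all_classical all_reals all_analysis.
Set Implicit Arguments.
Unset Strict Implicit.
Unset Printing Implicit Defensive.
Import Order.TTheory GRing.Theory Num.Theory.
Import numFieldNormedType.Exports.
Local Open Scope classical_set_scope.
Local Open Scope ring_scope.

HB.mixin Record isTopologicalGroup G & Topological G & Group G := {
  mulg_continuous : continuous (fun z : G * G => (z.1 * z.2)%g) ;
  invg_continuous : continuous (fun x : G => (x^-1)%g) }.

(* The distinguished point is arbitrary (not required to be 1): the library
   only puts generated sigma-algebras on pointed types. *)
#[short(type="topologicalGroupType")]
HB.structure Definition TopologicalGroup :=
  {G of PointedTopological G & Group G & isTopologicalGroup G}.

Notation borel G := (g_sigma_algebraType (@open G)).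

Definition locally_compact_group (G : topologicalGroupType) : Prop :=
  hausdorff_space G /\ locally_compact [set: G].

Definition subgroup (G : topologicalGroupType) (H : set G) : Prop :=
  group_closed [in H].

Definition compact_symmetric_generating_set (G : topologicalGroupType)
    (K : set G) : Prop :=
  [/\ compact K, [set x^-1%g | x in K] = K &
      smallest (@subgroup G) K = [set: G]].

Fixpoint set_power (G : topologicalGroupType) (K : set G) (n : nat) : set G :=
  if n is m.+1 then [set (x * y)%g | x in set_power K m & y in K]
  else [set 1%g].

(* The least n such that x is in K^n; the default 0 is never used when K is a
   symmetric generating set. *)
Definition word_length (G : topologicalGroupType) (K : set G) (x : G) : nat :=
  match pselect (exists n, `[< set_power K n x >]) with
  | left e => ex_minn e
  | right _ => 0%N
  end.

Definition translate (G : topologicalGroupType) (T : Type) (g : G)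
    (u : G -> T) : G -> T :=
  fun x => u (g^-1 * x)%g.

Definition bounded_continuous (R : realType) (G : topologicalGroupType)
    (u : G -> R) : Prop :=
  bounded_fun u /\ continuous u.

(* A left-invariant mean on the space of bounded continuous functions; the
   values of m on other functions are irrelevant. *)
Definition left_invariant_mean (R : realType) (G : topologicalGroupType)
    (m : (G -> R) -> R) : Prop :=
  [/\ forall (a : R) (u v : G -> R),
        bounded_continuous u -> bounded_continuous v ->
        m (fun x => a * u x + v x) = a * m u + m v,
      forall u : G -> R,
        bounded_continuous u -> (forall x, 0 <= u x) -> 0 <= m u,
      m (fun=> 1) = 1 &
      forall (g : G) (u : G -> R),
        bounded_continuous u -> m (translate g u) = m u].

(* For a locally compact group, a left-invariant mean on bounded continuous
   functions exists if and only if one exists on L^oo of the Haar measure. *)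
Definition amenable (R : realType) (G : topologicalGroupType) : Prop :=
  exists m : (G -> R) -> R, left_invariant_mean m.

Definition adapted (R : realType) (G : topologicalGroupType)
    (mu : probability (borel G) R) : Prop :=
  forall H : set G, closed H -> subgroup H -> mu H = 1%E -> H = [set: G].

Definition symmetric_measure (R : realType) (G : topologicalGroupType)
    (mu : probability (borel G) R) : Prop :=
  forall A : set (borel G), measurable A ->
    mu A = mu [set (x : G)^-1%g | x in A].

Definition has_third_moment (R : realType) (G : topologicalGroupType)
    (K : set G) (mu : probability (borel G) R) : Prop :=
  (\int[mu]_(s in [set: borel G])
     (((word_length K s)%:R : R) ^+ 3)%:E < +oo)%E.

Definition courteous (R : realType) (G : topologicalGroupType) (K : set G)
    (mu : probability (borel G) R) : Prop :=
  [/\ adapted mu, symmetric_measure mu & has_third_moment K mu].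

Definition mutually_independent (R : realType) d (Omega : measurableType d)
    (P : probability Omega R) d' (T : measurableType d')
    (U : nat -> {RV P >-> T}) : Prop :=
  forall (J : {fset nat}) (A : nat -> set T),
    (forall i, measurable (A i)) ->
    P (\bigcap_(i in [set` J]) (U i @^-1` A i)) =
      (\prod_(i <- J) P (U i @^-1` A i))%E.

Definition iid_with_law (R : realType) d (Omega : measurableType d)
    (P : probability Omega R) d' (T : measurableType d')
    (mu : probability T R) (U : nat -> {RV P >-> T}) : Prop :=
  mutually_independent U /\
  forall i (A : set T), measurable A -> distribution P (U i) A = mu A.

(* Increments are indexed from 0, so X_t = U_0 * ... * U_(t-1) and X_0 = 1. *)
Definition random_walk (R : realType) (G : topologicalGroupType) d
    (Omega : measurableType d) (P : probability Omega R)
    (U : nat -> {RV P >-> borel G}) (t : nat) (w : Omega) : G :=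
  (\prod_(i < t) (U i w : G))%g.

Definition converges_along_random_walks (R : realType)
    (G : topologicalGroupType) d (Omega : measurableType d)
    (P : probability Omega R) (X : nat -> Omega -> G) (f : G -> R) : Prop :=
  forall x : G, {ae P, forall w, cvgn (fun t => f (x * X t w)%g)}.

(* lne is the extended logarithm: lne 0 = -oo. *)
Definition subexponential_growth (R : realType) (G : topologicalGroupType)
    (K : set G) (f : G -> R) : Prop :=
  limn_esup (fun r : nat =>
    ((r%:R^-1)%:E *
     ereal_sup [set lne (`|f x|%:E) | x in [set x | (word_length K x <= r)%N]])%E)
  = 0%E.

Definition orbit_of (G : topologicalGroupType) (T : Type) (f : G -> T) :
    set (G -> T) :=
  [set translate g f | g in [set: G]].

Definition linear_span (R : realType) (V : lmodType R) (A : set V) : set V :=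
  [set v | exists (n : nat) (a : 'I_n -> R) (e : 'I_n -> V),
     (forall i, A (e i)) /\ v = \sum_(i < n) a i *: e i].

Definition finite_dimensional (R : realType) (V : lmodType R) (W : set V) :
    Prop :=
  exists (n : nat) (e : 'I_n -> V), W = linear_span (range e).

(* Main.v *)
Require Import Defs.
From mathcomp Require Import all_boot all_order perm all_algebra finmap.
From mathcomp Require Import all_classical all_reals all_analysis zify.
Import Order.TTheory GRing.Theory Num.Theory.
Import numFieldNormedType.Exports.
Local Open Scope classical_set_scope.
Local Open Scope ring_scope.
Set Implicit Arguments.
Unset Strict Implicit.
Unset Printing Implicit Defensive.

(** The kernel [increment f y g = f (y g) - f y] has finite rank [d], so it
    factors as [c g *m p y], where [c] is a cocycle for a matrix-valued
    antihomomorphism [rho]: [c (g g') = c g + c g' *m rho g] and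
    [p (y g) = rho g *m p y].  Sub-exponential growth along the powers of [g]
    and of [g^-1] forces [`|\det (rho g)| = 1].

    Suppose [d > 0].  By adaptedness and symmetry the support of [mu] generates
    a dense subgroup, so the cocycles of words in the support span, and a rank
    argument yields a single such word whose prefixes have spanning cocycles.
    By independence the walk almost surely reads a word close to this one
    infinitely often; each time, the increments of [f] along the prefixes, seen
    from the points [x_i X_t], form a matrix whose determinant is bounded away
    from 0 because [rho X_t] preserves volumes.  But these increments tend to 0
    when [f] converges along the walk.  Hence [d = 0] and [f] is constant. *)

(** * The affine cocycle of a function of finite rank *)

(* [d] is the largest size of an invertible minor; the formula for [k] says that
   the Schur complement of this minor in any bordered one vanishes. *)
Lemma finite_rank_skeleton (R : fieldType) (X Y : Type) (k : X -> Y -> R)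
    (n : nat) (a : 'I_n -> X -> R) (e : 'I_n -> Y -> R) :
  (forall x y, k x y = \sum_i a i x * e i y) ->
  exists (d : nat) (x : 'I_d -> X) (y : 'I_d -> Y),
    let N := \matrix_(j, i) k (x i) (y j) in
    N \in unitmx /\
    forall x0 y0,
      k x0 y0 = ((\row_i k (x i) y0) *m invmx N *m (\col_j k x0 (y j))) 0 0.
Proof.
move=> kE.
pose P d := exists (x : 'I_d -> X) (y : 'I_d -> Y),
  (\matrix_(j, i) k (x i) (y j)) \in unitmx.
have P_le d : `[< P d >] -> (d <= n)%N.
  move=> /asboolP[x [y]]; rewrite -row_full_unit => /eqP <-.
  set N := \matrix_(j, i) _.
  suff -> : N = (\matrix_(j, i) e i (y j)) *m (\matrix_(i, j) a i (x j)).
    exact: mulmx_max_rank.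
  by apply/matrixP => i j; rewrite !mxE kE; apply: eq_bigr => l _;
    rewrite !mxE mulrC.
have P0 : exists d, `[< P d >].
  exists 0%N; apply/asboolP.
  have z (T : Type) : 'I_0 -> T by case.
  by exists (z X), (z Y); rewrite unitmxE det_mx00 unitr1.
case: (ex_maxnP P0 P_le) => d /asboolP[x [y Nu]] dmax.
exists d, x, y; split=> // x0 y0.
set N := (\matrix_(j, i) _) in Nu *; set q := \row_i _; set p := \col_j _.
apply/eqP; rewrite -subr_eq0; apply/negPn/negP => z0.
pose x' (i : 'I_(d + 1)) := if fintype.split i is inl i' then x i' else x0.
pose y' (i : 'I_(d + 1)) := if fintype.split i is inl i' then y i' else y0.
suff /dmax : `[< P (d + 1)%N >] by rewrite addn1 ltnn.
apply/asboolP; exists x', y'.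
have -> : \matrix_(j, i) k (x' i) (y' j) = block_mx N p q (k x0 y0)%:M.
  apply/matrixP => i j; rewrite !mxE /x' /y'.
  case: (fintype.split i) => i'; rewrite !mxE;
    case: (fintype.split j) => j'; rewrite !mxE//.
  by rewrite !ord1 mulr1n.
(* Block elimination leaves the Schur complement in the corner, nonzero by [z0], so the bordered
   minor is invertible, against the maximality of [d]. *)
have : \det (block_mx 1%:M 0 (- (q *m invmx N)) 1%:M *m
             block_mx N p q (k x0 y0)%:M) != 0.
  rewrite mulmx_block !mul1mx !mul0mx !addr0 !mulNmx.
  rewrite -[X in block_mx _ _ (- X + _) _]mulmxA mulVmx// mulmx1.
  rewrite addNr det_ublock mulf_eq0 negb_or -unitfE -unitmxE Nu /=.
  rewrite det_mx11.  by rewrite mxE mxE [_%:M 0 0]mxE mulr1n addrC.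
rewrite det_mulmx det_lblock !det1 !mul1r => D.
by rewrite unitmxE unitfE.
Qed.

Section AffineCocycle.
Variables (R : fieldType) (G : groupType) (f : G -> R).
Variables (d : nat) (x h : 'I_d -> G).

Definition increment (y g : G) : R := f (y * g)%g - f y.

Definition pairing : 'M[R]_d := \matrix_(j, i) increment (x i) (h j).

(** Under [incrementE], the coordinates of [increment ^~ g] in the functions [increment ^~ (h j)],
    recovered from the base points [x i]. *)
Definition cocycle (g : G) : 'rV[R]_d :=
  (\row_i increment (x i) g) *m invmx pairing.

(** Since [cocycle (h j)] is the [j]-th unit vector, the cocycle identity leaves no other choice for
    row [j]. *)
Definition linear_part (g : G) : 'M[R]_d :=
  \matrix_j (cocycle (g * h j)%g - cocycle g).

Definition covector (y : G) : 'cV[R]_d := \col_j increment y (h j).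

Hypothesis pairing_unit : pairing \in unitmx.
Hypothesis incrementE : forall y g,
  increment y g = (cocycle g *m covector y) 0 0.

Lemma increment1 y : increment y 1%g = 0.
Proof. by rewrite /increment mulg1 subrr. Qed.

Lemma incrementM y g g' :
  increment (y * g)%g g' = increment y (g * g')%g - increment y g.
Proof. by rewrite /increment mulgA opprB addrA subrK. Qed.

Lemma cocycle1 : cocycle 1%g = 0.
Proof.
rewrite /cocycle (_ : \row_i _ = 0) ?mul0mx//.
by apply/rowP => i; rewrite !mxE increment1.
Qed.

Lemma increment_row g : \row_i increment (x i) g = cocycle g *m pairing.
Proof. by rewrite mulmxKV. Qed.

Lemma pairing_translate g :
  \matrix_(j, i) increment (x i * g)%g (h j) = linear_part g *m pairing.
Proof.
apply/matrixP => j i; rewrite mxE incrementM !incrementE.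
have -> : (linear_part g *m pairing) j i
  = (row j (linear_part g) *m covector (x i)) 0 0.
  by rewrite !mxE; apply: eq_bigr => l _; rewrite !mxE.
by rewrite rowK mulmxBl [RHS]mxE [X in _ = _ + X]mxE.
Qed.

(** Right multiplication by the invertible [pairing] reduces the identity to the base points [x i],
    where it is [incrementM]. *)
Lemma cocycleM g g' :
  cocycle (g * g')%g = cocycle g + cocycle g' *m linear_part g.
Proof.
apply: (can_inj (mulmxK pairing_unit)) => /=.
rewrite mulmxDl -(mulmxA (cocycle g')) -pairing_translate -!increment_row.
apply/rowP => i; rewrite !mxE.
have := incrementM (x i) g g' => /eqP; rewrite eq_sym subr_eq addrC => /eqP ->.
congr (_ + _); rewrite incrementE !mxE; apply: eq_bigr => j _.
by rewrite !mxE.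
Qed.

Lemma cocycle_basis j : cocycle (h j) = delta_mx 0 j.
Proof.
rewrite /cocycle (_ : \row_i _ = row j pairing); last first.
  by apply/rowP => i; rewrite !mxE.
by rewrite -row_mul mulmxV// row1.
Qed.

Lemma linear_part1 : linear_part 1%g = 1%:M.
Proof.
by apply/row_matrixP => j; rewrite rowK mul1g cocycle1 subr0 cocycle_basis row1.
Qed.

Lemma linear_partM g g' :
  linear_part (g * g')%g = linear_part g' *m linear_part g.
Proof.
apply/row_matrixP => j; rewrite row_mul !rowK -mulgA !(cocycleM g).
by rewrite mulmxBl opprD addrACA subrr add0r.
Qed.

(** Separates the position [y] from the words [g j], so that for [m = d] the determinant is a
    product. *)
Lemma increments_translate m (y : G) (g : 'I_m -> G) :
  \matrix_(j, i) increment (x i * y)%g (g j) =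
  (\matrix_j cocycle (g j)) *m linear_part y *m pairing.
Proof.
rewrite -mulmxA -pairing_translate.
apply/matrixP => j i; rewrite !mxE incrementE !mxE.
by apply: eq_bigr => l _; rewrite !mxE.
Qed.

End AffineCocycle.

(** * Determinants, word length and growth *)

Lemma ler_norm_det (R : realFieldType) (d : nat) (M : 'M[R]_d) (b : R) :
  (forall i j, `|M i j| <= b) -> `|\det M| <= d`!%:R * b ^+ d.
Proof.
move=> Mb; apply: le_trans (ler_norm_sum _ _ _) _.
rewrite -(card_Sn d) mulr_natl -sumr_const; apply: ler_sum => s _.
rewrite normrM normrX normrN1 expr1n mul1r normr_prod.
rewrite -[X in b ^+ X]card_ord -prodr_const.
by apply: ler_prod => i _; rewrite normr_ge0 Mb.
Qed.

Lemma cvg_det (R : realType) (d : nat) (T : Type) (F : set_system T)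
    (M : T -> 'M[R]_d) (L : 'M[R]_d) :
  Filter F -> (forall i j, M t i j @[t --> F] --> L i j) ->
  \det (M t) @[t --> F] --> \det L.
Proof.
move=> FF ML; apply: (@cvg_big _ _ +%R 0); first exact: add_continuous.
move=> s _; apply: cvgM; first exact: cvg_cst.
apply: (@cvg_big R _ *%R 1 _ _ _ _ _ (fun i t => M t i (s i))
  (fun i => L i (s i))) => //; exact: mul_continuous.
Qed.

Section WordLength.
Variables (G : topologicalGroupType) (K : set G).

Lemma set_powerM m n x y :
  set_power K m x -> set_power K n y -> set_power K (m + n) (x * y)%g.
Proof.
move=> Kx; elim: n y => [|n IHn] y /=.
  by rewrite addn0 => ->; rewrite mulg1.
move=> [z Kz [k Kk <-]]; rewrite addnS mulgA.
by exists (x * z)%g; [exact: IHn|exists k].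
Qed.

Lemma word_length_le n x : set_power K n x -> (word_length K x <= n)%N.
Proof.
move=> Kx; rewrite /word_length; case: pselect => // e.
by case: ex_minnP => m _; apply; exact/asboolP.
Qed.

Lemma set_powerV n x : [set y^-1%g | y in K] = K ->
  set_power K n x -> set_power K n (x^-1)%g.
Proof.
move=> KV; elim: n x => [|n IHn] x /=; first by move->; rewrite invg1.
move=> [z Kz [k Kk <-]]; rewrite invgM.
have Kk' : set_power K 1 (k^-1)%g.
  by exists 1%g => //; exists (k^-1)%g; rewrite ?mul1g// -KV; exists k.
exact: (set_powerM Kk' (IHn _ Kz)).
Qed.

Lemma set_power_subgroup : [set y^-1%g | y in K] = K ->
  subgroup [set y | exists n, set_power K n y].
Proof.
move=> KV; split=> [|y z]; rewrite !inE; first by exists 0%N.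
move=> [m Ky] [n Kz]; exists (m + n)%N.
exact: set_powerM Ky (set_powerV KV Kz).
Qed.

Hypothesis K_gen : compact_symmetric_generating_set K.

Lemma set_power_cover x : exists n, set_power K n x.
Proof.
have [_ KV Kgen] := K_gen.
suff : [set: G] `<=` [set y | exists n, set_power K n y] by exact.
rewrite -Kgen; apply: smallest_sub; first exact: set_power_subgroup.
by move=> k Kk; exists 1%N; exists 1%g => //; exists k; rewrite ?mul1g.
Qed.

Lemma set_power_word_length x : set_power K (word_length K x) x.
Proof.
rewrite /word_length; case: pselect => [e|ne].
  by case: ex_minnP => m /asboolP.
by exfalso; apply: ne; have [n Kx] := set_power_cover x; exists n; apply/asboolP.
Qed.

Lemma word_lengthM x y :
  (word_length K (x * y)%g <= word_length K x + word_length K y)%N.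
Proof.
by apply: word_length_le; apply: set_powerM; exact: set_power_word_length.
Qed.

Lemma word_lengthX x n : (word_length K (x ^+ n)%g <= n * word_length K x)%N.
Proof.
elim: n => [|n IHn]; first by rewrite expg0 mul0n; exact: word_length_le.
by rewrite expgS mulSn (leq_trans (word_lengthM _ _))// leq_add2l.
Qed.

Lemma subexponential_bound (R : realType) (f : G -> R) (e : R) :
  subexponential_growth K f -> 0 < e ->
  exists r0 : nat, forall r x, (r0 <= r)%N -> (word_length K x <= r)%N ->
    `|f x| <= expR (e * r%:R).
Proof.
rewrite /subexponential_growth; set u := (fun r : nat => _) => u0 e0.
have : (ereal_inf (range (esups u)) < e%:E)%E.
  by rewrite -(cvg_lim _ (@cvg_esups_inf _ u))// -limn_esup_lim u0 lte_fin.
(* The threshold [n.+1] keeps [r] positive, so that the factor [1 / r] can be cleared. *)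
move=> /ereal_inf_lt[_ [n _ <-]] ne; exists n.+1 => r x nr xr.
have r0 : (0 : R) < r%:R by rewrite ltr0n (leq_trans _ nr).
have : (u r <= e%:E)%E.
  apply: le_trans (ltW ne); apply: ereal_sup_ubound.
  by exists r => //=; exact: ltnW.
rewrite /u; set s := ereal_sup _ => us.
have xs : (lne `|f x|%:E <= s)%E by apply: ereal_sup_ubound; exists x.
have {xs us} : (lne `|f x|%:E <= (e * r%:R)%:E)%E.
  by apply: (le_trans xs); rewrite mulrC EFinM -lee_pdivrMl.
have [fx0|fx0] := ltP 0 `|f x|.
  by rewrite lne_EFin// lee_fin => ?; rewrite -[leLHS]lnK// ler_expR.
by move=> _; apply: le_trans fx0 _; exact: expR_ge0.
Qed.

End WordLength.

(** If [D > 1], then [D ^+ k] is the square of [expR (e * k%:R)] with [e = ln D / 2], and a single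
    factor eventually exceeds [C]. *)
Lemma le1_of_subexponential_powers (R : realType) (D : R) :
  (forall e, 0 < e -> exists C (r0 : nat), forall k : nat, (r0 <= k)%N ->
     D ^+ k <= C * expR (e * k%:R)) -> D <= 1.
Proof.
move=> DC; rewrite leNgt; apply/negP => D1.
have D0 : 0 < D by exact: lt_trans D1.
have e0 : 0 < ln D / 2 by rewrite divr_gt0// ln_gt0.
have [C [r0 {}DC]] := DC _ e0; set e := ln D / 2 in e0 DC.
have lnD : ln D = e + e by rewrite -mulr2n -mulr_natr mulfVK.
pose k := maxn r0 (Num.truncn (`|C| / e)).+1.
have := DC k (leq_maxl _ _).
rewrite -[D]lnK ?posrE// -expRM_natr lnD mulrDl expRD ler_pM2r ?expR_gt0//.
apply/negP; rewrite -ltNge.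
apply: lt_le_trans (expR_ge1Dx _); rewrite ltr_wpDl//.
apply: le_lt_trans (ler_norm _) _; rewrite mulrC -ltr_pdivrMr//.
apply: lt_le_trans (truncnS_gt _) _.
by rewrite ler_nat leq_maxr.
Qed.

Section UnimodularLinearPart.
Variables (R : realType) (G : topologicalGroupType) (K : set G) (f : G -> R).
Variables (d : nat) (x h : 'I_d -> G).
Hypothesis K_gen : compact_symmetric_generating_set K.
Hypothesis f_growth : subexponential_growth K f.
Hypothesis pairing_unit : pairing f x h \in unitmx.
Hypothesis incrementE : forall y g,
  increment f y g = (cocycle f x h g *m covector f h y) 0 0.

Lemma linear_partX g k :
  \det (linear_part f x h (g ^+ k)%g) = \det (linear_part f x h g) ^+ k.
Proof.
elim: k => [|k IHk]; first by rewrite expg0 linear_part1// det1.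
by rewrite expgS linear_partM// det_mulmx IHk exprSr.
Qed.

(** By [pairing_translate], [\det (linear_part g) ^+ k] is, up to a constant factor, a determinant
    of increments of [f] between points whose word length is linear in [k], so it grows
    sub-exponentially. *)
Lemma det_linear_part_le1 g : `|\det (linear_part f x h g)| <= 1.
Proof.
apply: le1_of_subexponential_powers => e e0.
(* Every point at which [f] is evaluated has length at most [m + k * a]; the successor gives
   [k <= k * a]. *)
pose a := (word_length K g).+1.
pose m := (\sum_i word_length K (x i) + \sum_j word_length K (h j))%N.
(* The determinant multiplies the rate [e' * a] by [d]; [d.+1] keeps the divisor positive when
   [d = 0]. *)
have [e' e'0 e'E] : exists2 e', 0 < e' & e = e' * (a * d.+1)%:R.
  have ad0 : 0 < (a * d.+1)%:R :> R by rewrite ltr0n muln_gt0.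
  by exists (e / (a * d.+1)%:R); rewrite ?divr_gt0// divfK// gt_eqF.
have [r0 fr0] := subexponential_bound f_growth e'0.
have N0 : 0 < `|\det (pairing f x h)|.
  by rewrite normr_gt0 -unitfE -unitmxE.
exists (d`!%:R * 2 ^+ d * expR (e' * m%:R * d%:R) / `|\det (pairing f x h)|), r0.
move=> k r0k; rewrite mulrAC ler_pdivlMr//.
rewrite -normrX -linear_partX -normrM -det_mulmx -pairing_translate//.
apply: le_trans (ler_norm_det (b := 2 * expR (e' * (m + k * a)%:R)) _) _.
  move=> j i; rewrite mxE /increment mulr_natl mulr2n.
  have r0m : (r0 <= m + k * a)%N.
    by rewrite (leq_trans r0k)// (leq_trans _ (leq_addl _ _))// leq_pmulr.
  have xi : (word_length K (x i) <= \sum_i word_length K (x i))%N.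
    by rewrite (bigD1 i)//= leq_addr.
  have hj : (word_length K (h j) <= \sum_j word_length K (h j))%N.
    by rewrite (bigD1 j)//= leq_addr.
  have gk : (word_length K (g ^+ k)%g <= k * a)%N.
    by rewrite (leq_trans (word_lengthX K_gen _ _))// leq_mul2l leqnSn orbT.
  have xg : (word_length K (x i * g ^+ k)%g <=
      \sum_i word_length K (x i) + k * a)%N.
    by rewrite (leq_trans (word_lengthM K_gen _ _))// leq_add.
  apply: le_trans (ler_normB _ _) _; apply: lerD; apply: fr0 => //.
    rewrite (leq_trans (word_lengthM K_gen _ _))//.
    by rewrite (leq_trans (leq_add xg hj))// /m addnAC.
  by rewrite (leq_trans xg)// /m -addnA leq_add2l leq_addl.
rewrite exprMn -!mulrA; do 2 rewrite ler_wpM2l ?exprn_ge0//.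
rewrite -expRM_natr -expRD ler_expR e'E -!mulrA -mulrDr ler_pM2l// -!natrM -natrD.
by rewrite ler_nat; nia.
Qed.

Lemma norm_det_linear_part g : `|\det (linear_part f x h g)| = 1.
Proof.
apply/eqP; rewrite eq_le det_linear_part_le1/=.
have : `|\det (linear_part f x h g)| * `|\det (linear_part f x h g^-1%g)| = 1.
  by rewrite -normrM -det_mulmx -linear_partM// mulVg linear_part1// det1 normr1.
move=> {1}<-; rewrite ler_piMr//; exact: det_linear_part_le1.
Qed.

End UnimodularLinearPart.

(** * Support of a probability measure, seen through finitely many functions *)

Section Support.
Variables (R : realType) (T : ptopologicalType) (I : finType).
Variable phi : I -> T -> R.
Hypothesis phi_continuous : forall i, continuous (phi i).

Definition box (a : I -> R) (e : R) : set T :=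
  [set s | forall i, `|phi i s - a i| < e].

Lemma box_open a e : open (box a e).
Proof.
rewrite openE => s sb; apply: filter_forall => i.
have : `|phi i t - a i| @[t --> s] --> `|phi i s - a i|.
  by apply: cvg_norm; apply: cvgB; [exact: phi_continuous|exact: cvg_cst].
by move=> /cvgr_lt; apply; exact: sb.
Qed.

(* The topological support of [mu] can be too small when [T] is not second
   countable, so neighbourhoods are taken for the coarser topology of [phi]. *)
Lemma null_off_support (mu : probability (borel T) R) :
  exists N : set T, [/\ open N, mu N = 0 &
    forall s, ~ N s -> forall e, 0 < e -> (0 < mu (box (phi ^~ s) e))%E].
Proof.
(* Countably many boxes with rational centre and radius [1 / m.+1], enumerated by [unpickle]; codes
   without a null box give the empty set. *)
pose B (n : nat) : set T :=
  if (choice.unpickle n : option ({ffun I -> rat} * nat)) is Some (q, m) then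
    let b := box (fun i => ratr (q i)) m.+1%:R^-1 in
    if mu b == 0 then b else set0
  else set0.
have B_open n : open (B n).
  rewrite /B; case: choice.unpickle => [[q m]|] /=; last exact: open0.
  by case: ifP => _; [exact: box_open|exact: open0].
have B_null n : mu (B n) = 0.
  rewrite /B; case: choice.unpickle => [[q m]|] /=; last exact: measure0.
  by case: ifPn => [/eqP//|_]; exact: measure0.
have N_open : open (\bigcup_n B n) by exact: bigcup_open.
exists (\bigcup_n B n); split=> //.
  apply/negligibleP; first exact: sub_sigma_algebra.
  apply: negligible_bigcup => n; apply/negligibleP; last exact: B_null.
  exact: sub_sigma_algebra.
move=> s Ns e e0.
rewrite lt_neqAle measure_ge0 andbT eq_sym; apply/negP => /eqP se.
(* A rational box that contains [s] and has radius at most [e / 2] lies in the supposedly null box,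
   so it is one of the [B n]. *)
apply: Ns; pose m := Num.truncn (2 / e).
have m0 : 0 < m.+1%:R^-1 :> R by rewrite invr_gt0.
have me : m.+1%:R^-1 + m.+1%:R^-1 <= e.
  rewrite -mulr2n -[_ *+ 2]mulr_natl ler_pdivrMr// mulrC -ler_pdivrMr//.
  by apply: ltW; exact: truncnS_gt.
have /choice[q qP] i : exists q : rat, `|phi i s - ratr q| < m.+1%:R^-1.
  have : phi i s - m.+1%:R^-1 < phi i s + m.+1%:R^-1.
    by rewrite ltrD2l gtrN.
  move=> /rat_in_itvoo[q]; rewrite in_itv/= => /andP[q1 q2]; exists q.
  by rewrite distrC ltr_distl q1 q2.
pose b := box (fun i => ratr ([ffun i => q i] i)) m.+1%:R^-1.
have bs : b s by move=> i; rewrite ffunE.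
exists (choice.pickle ([ffun i => q i], m)) => //.
rewrite /B choice.pickleK -/b ifT//.
apply/eqP/le_anti; rewrite measure_ge0 andbT -se.
apply: le_measure.
- by apply: mem_set; apply: (@sub_sigma_algebra T setT open); exact: box_open.
- by apply: mem_set; apply: (@sub_sigma_algebra T setT open); exact: box_open.
move=> y yb i; have := bs i; have := yb i; rewrite ffunE => yi si.
apply: le_lt_trans (ler_distD (ratr (q i)) _ _) (lt_le_trans _ me).
by rewrite ltrD// distrC.
Qed.

End Support.

(** * Words *)

Lemma subgroup_closure (G : topologicalGroupType) (H : set G) :
  subgroup H -> subgroup (closure H).
Proof.
move=> [H1 HM]; split=> [|x y]; rewrite !inE.
  by apply: subset_closure; move: H1; rewrite inE.
move=> Hx Hy B Bxy.
have : (fun z : G * G => (z.1 * z.2^-1)%g) @ (nbhs x, nbhs y) --> (x * y^-1)%g.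
  have -> : (fun z : G * G => (z.1 * z.2^-1)%g) =
    (fun z : G * G => (z.1 * z.2)%g) \o (fun z : G * G => (z.1, z.2^-1%g)) by [].
  apply: cvg_comp; last exact: (@mulg_continuous G (x, y^-1%g)).
  apply: cvg_pair; first exact: cvg_fst.
  by apply: cvg_comp cvg_snd _; exact: invg_continuous.
move=> /(_ _ Bxy)[[A C] /= [Ax Cy] AC].
have [z [Hz Az]] := Hx _ Ax; have [w [Hw Cw]] := Hy _ Cy.
exists (z * w^-1)%g; split; last exact: (AC (z, w)).
by have := HM z w; rewrite !inE; apply.
Qed.

Section Words.
Variable G : groupType.

(** Convertible to [random_walk] when [v] is the sequence of increments at a sample point. *)
Definition word_prod (v : nat -> G) (n : nat) : G := (\prod_(i < n) v i)%g.

Lemma word_prod0 v : word_prod v 0 = 1%g.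
Proof. exact: big_ord0. Qed.

Lemma word_prodSr v n : word_prod v n.+1 = (word_prod v n * v n)%g.
Proof. exact: big_ord_recr. Qed.

Lemma word_prodD v m n :
  word_prod v (m + n) = (word_prod v m * word_prod (fun i => v (m + i)%N) n)%g.
Proof.
elim: n => [|n IHn]; first by rewrite addn0 word_prod0 mulg1.
by rewrite addnS !word_prodSr IHn mulgA.
Qed.

Lemma eq_word_prod v w n : (forall i, (i < n)%N -> v i = w i) ->
  word_prod v n = word_prod w n.
Proof. by move=> vw; apply: eq_bigr => i _; exact: vw. Qed.

End Words.

Section CocycleOnWords.
Variables (R : realType) (G : topologicalGroupType) (d : nat).
Variables (c : G -> 'rV[R]_d) (rho : G -> 'M[R]_d).
Hypothesis rho1 : rho 1%g = 1%:M.
Hypothesis cM : forall g g', c (g * g')%g = c g + c g' *m rho g.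
Hypothesis rhoM : forall g g', rho (g * g')%g = rho g' *m rho g.

Lemma set_power_word_prod (S : set G) n g : set_power S n g ->
  exists v, (forall i, (i < n)%N -> S (v i)) /\ word_prod v n = g.
Proof.
elim: n g => [|n IHn] g /=.
  by move->; exists (fun=> 1%g); rewrite word_prod0.
move=> [z /IHn[v [Sv <-]] [s Ss <-]].
exists (fun i => if (i < n)%N then v i else s); split=> [i|].
  by case: ifP => // *; exact: Sv.
rewrite word_prodSr ltnn; congr (_ * s)%g.
by apply: eq_word_prod => i ->.
Qed.

Definition prefix_mx (v : nat -> G) (n : nat) : 'M[R]_(n.+1, d) :=
  \matrix_(k < n.+1) c (word_prod v k).

Lemma prefix_mx_kernel v n m (L : 'M[R]_(d, m)) (k : nat) :
  prefix_mx v n *m L = 0 -> (k <= n)%N -> c (word_prod v k) *m L = 0.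
Proof.
rewrite -ltnS => vL kn.
have := row_mul (Ordinal kn) (prefix_mx v n) L.
by rewrite vL row0 rowK /= => <-.
Qed.

(** A word [v] of maximal rank works. The cokernel [L] of its prefix cocycles also kills those of
    its extensions, so [rho (word_prod v n) *m L] kills the cocycle of every word in [S] and
    vanishes by the hypothesis, which is spanning in dual form. As [rho] takes invertible values,
    [L = 0]. *)
Lemma full_word (S : set G) :
  (forall L : 'M[R]_d,
     (forall n g, set_power S n g -> c g *m L = 0) -> L = 0) ->
  exists v n, (forall i, (i < n)%N -> S (v i)) /\ row_full (prefix_mx v n).
Proof.
move=> S_spans.
pose P r := exists v n, (forall i, (i < n)%N -> S (v i)) /\
  \rank (prefix_mx v n) = r.
have P_le r : `[< P r >] -> (r <= d)%N.
  by move=> /asboolP[v [n [_ <-]]]; exact: rank_leq_col.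
have P_ex : exists r, `[< P r >].
  by eexists; apply/asboolP; exists (fun=> 1%g), 0%N; split.
case: (ex_maxnP P_ex P_le) => r /asboolP[v [n [Sv vr]]] r_max.
exists v, n; split=> //; rewrite /row_full.
set L := cokermx (prefix_mx v n).
suff L0 : L = 0.
  have := mxrank_coker (prefix_mx v n); rewrite -/L L0 mxrank0.
  by move/esym/eqP; rewrite subn_eq0 => ?; rewrite eqn_leq rank_leq_col.
have vL : prefix_mx v n *m L = 0 by exact: mulmx_coker.
suff : rho (word_prod v n) *m L = 0.
  move/(congr1 (mulmx (rho (word_prod v n)^-1%g))).
  by rewrite mulmx0 mulmxA -rhoM mulgV rho1 mul1mx.
apply: S_spans => m g /set_power_word_prod[w [Sw <-]].
pose u i := if (i < n)%N then v i else w (i - n)%N.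
have uv k : (k <= n)%N -> word_prod u k = word_prod v k.
  by move=> kn; apply: eq_word_prod => i ik; rewrite /u (leq_trans ik kn).
have un : word_prod u (n + m) = (word_prod v n * word_prod w m)%g.
  rewrite word_prodD uv//; congr (_ * _)%g.
  by apply: eq_word_prod => i _; rewrite /u ltnNge leq_addr addKn.
have vu : (prefix_mx v n <= prefix_mx u (n + m))%MS.
  apply/row_subP => k; have kn : (k <= n)%N by rewrite -ltnS.
  have knm : (k < (n + m).+1)%N by rewrite ltnS (leq_trans kn)// leq_addr.
  by apply: (eq_row_sub (Ordinal knm)); rewrite !rowK uv.
(* Maximality of [r]: continuing [v] by [w] does not enlarge the row space. *)
have : (prefix_mx u (n + m) <= prefix_mx v n)%MS.
  rewrite -(mxrank_leqif_sup vu) eqn_leq (mxrankS vu) vr /=.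
  apply: r_max; apply/asboolP; exists u, (n + m)%N; split=> // i inm.
  rewrite /u; case: ltnP => [|ni]; first exact: Sv.
  by apply: Sw; rewrite ltn_subLR.
move=> /submxP[D uD].
have uL : prefix_mx u (n + m) *m L = 0 by rewrite uD -mulmxA vL mulmx0.
have := prefix_mx_kernel uL (leqnn _).
by rewrite un cM mulmxDl (prefix_mx_kernel vL)// add0r -mulmxA.
Qed.

(** Adjoins [c g] to [rho g] as an extra row, indexed by [None]. The values at a product are then
    polynomials in those at the factors. *)
Definition coordinate (i : option 'I_d * 'I_d) (g : G) : R :=
  if i.1 is Some j then rho g j i.2 else c g 0 i.2.

Lemma coordinateM_linear j a g g' : coordinate (Some j, a) (g * g')%g =
  \sum_l coordinate (Some j, l) g' * coordinate (Some l, a) g.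
Proof. by rewrite /coordinate/= rhoM mxE. Qed.

Lemma coordinateM_cocycle a g g' : coordinate (None, a) (g * g')%g =
  coordinate (None, a) g +
  \sum_l coordinate (None, l) g' * coordinate (Some l, a) g.
Proof. by rewrite /coordinate/= cM !mxE. Qed.

Lemma cvg_coordinate_word_prod (v_ : nat -> nat -> G) (v : nat -> G) (n : nat) :
  (forall i k, (k < n)%N ->
     coordinate i (v_ t k) @[t --> \oo] --> coordinate i (v k)) ->
  forall i k, (k <= n)%N ->
    coordinate i (word_prod (v_ t) k) @[t --> \oo] -->
    coordinate i (word_prod v k).
Proof.
move=> vv + k; elim: k => [|k IHk] => [i|[[j|] a]] kn.
- rewrite word_prod0; under eq_cvg do rewrite word_prod0; exact: cvg_cst.
- rewrite word_prodSr coordinateM_linear.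
  under eq_cvg do rewrite word_prodSr coordinateM_linear.
  apply: (@cvg_big R _ +%R 0 _ (@add_continuous R)) => l _.
  by apply: cvgM; [exact: vv|apply: IHk; exact: ltnW].
- rewrite word_prodSr coordinateM_cocycle.
  under eq_cvg do rewrite word_prodSr coordinateM_cocycle.
  apply: cvgD; first by apply: IHk; exact: ltnW.
  apply: (@cvg_big R _ +%R 0 _ (@add_continuous R)) => l _.
  by apply: cvgM; [exact: vv|apply: IHk; exact: ltnW].
Qed.

(** [D w] is a polynomial in the coordinates of the letters. Counterexamples with tolerance
    [1 / m.+1] would converge coordinatewise to [v] and contradict its continuity. *)
Lemma det_words_stable (v : nat -> G) (n : nat) (k : 'I_d -> nat) :
  (forall j, (k j <= n)%N) ->
  let D w := \det (\matrix_j c (word_prod w (k j))) in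
  D v != 0 ->
  exists e, 0 < e /\ forall w : nat -> G,
    (forall i, (i < n)%N -> box coordinate (coordinate ^~ (v i)) e (w i)) ->
    `|D v| / 2 < `|D w|.
Proof.
move=> kn D Dv; apply: contrapT => noe.
have /choice[w wP] m : exists w : nat -> G,
    (forall i, (i < n)%N ->
      box coordinate (coordinate ^~ (v i)) m.+1%:R^-1 (w i)) /\
    `|D w| <= `|D v| / 2.
  apply: contrapT => now; apply: noe; exists m.+1%:R^-1; split=> // w vw.
  by rewrite ltNge; apply/negP => Dw; apply: now; exists w.
have Dw : D (w m) @[m --> \oo] --> D v.
  apply: cvg_det => j a; rewrite !mxE.
  under eq_cvg do rewrite !mxE.
  apply: (cvg_coordinate_word_prod (i := (None, a)) _ (kn j)) => i l ln.
  apply/cvgrPdist_lt => e e0.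
  have : \forall m \near \oo, m.+1%:R^-1 < e.
    exact: near_infty_natSinv_lt (PosNum e0).
  apply: filterS => m me; rewrite distrC; apply: lt_trans me.
  by have [+ _] := wP m; apply.
have half : `|D v| / 2 < `|D v|.
  by rewrite ltr_pdivrMr// ltr_pMr ?normr_gt0// ltr1n.
have [m _ /(_ m (leqnn m))/=] := cvgr_gt _ (cvg_norm Dw) _ half.
by apply/negP; rewrite -leNgt; have [] := wP m.
Qed.

End CocycleOnWords.

(** * Random walks *)

(** Although windows may overlap, each one matches with the same probability [beta > 0], so every
    tail union, and with it the limit superior, has probability at least [beta]. Positive
    probability is enough to meet the almost sure event [Q]. *)
Lemma patterns_recur (R : realType) d (Omega : measurableType d)
    (P : probability Omega R) d' (T : measurableType d')
    (mu : probability T R) (U : nat -> {RV P >-> T}) (n : nat)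
    (A : nat -> set T) (Q : set Omega) :
  iid_with_law mu U ->
  (forall i, measurable (A i)) -> (forall i, (i < n)%N -> (0 < mu (A i))%E) ->
  {ae P, forall w, Q w} ->
  exists w, Q w /\ forall m, exists2 t, (m <= t)%N &
    forall i, (i < n)%N -> A i (U (t + i)%N w).
Proof.
move=> [U_indep U_law] mA A_gt0 aeQ.
pose J t : {fset nat} := [fset (t + i)%N | i in iota 0 n]%fset.
pose B t : set Omega := \bigcap_(i in [set` J t]) (U i @^-1` A (i - t)%N).
(* Indexed by the list that [big_imfset] returns. *)
pose beta := (\prod_(i <- enum_finmem (mem (iota 0 n))) mu (A i))%E.
have beta_gt0 : (0 < beta)%E.
  rewrite /beta big_seq; apply: (big_ind (fun x => (0 < x)%E)) => //.
    by move=> x y; exact: mule_gt0.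
  by move=> i; rewrite enum_finmemE mem_iota; exact: A_gt0.
have mB t : measurable (B t).
  apply: bigcap_measurableType => i _; rewrite -[_ @^-1` _]setTI.
  exact: measurable_funP.
have PB t : P (B t) = beta.
  rewrite (U_indep _ (fun i => A (i - t)%N))// big_imfset/=; last first.
    by move=> i j _ _ /addnI.
  apply: eq_bigr => i _; rewrite -(U_law (t + i)%N)//.
  by rewrite /distribution /pushforward addKn.
have P_limsup : (0 < P (lim_sup_set B))%E.
  apply: lt_le_trans beta_gt0 _.
  have mtail m : measurable (\bigcup_(k in [set k | (m <= k)%N]) B k).
    by apply: bigcup_measurable => k _.
  have lB := lim_sup_set_cvg P B mB
    (le_lt_trans (probability_le1 _ (mtail 0%N)) (ltry _)).
  rewrite -(cvg_lim _ lB)//; apply: lime_ge.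
    by apply/cvg_ex; eexists; exact: lB.
  apply: nearW => t; rewrite -(PB t); apply: le_measure; rewrite ?inE//.
  by apply: bigcup_sup => /=.
apply: contrapT => noQ.
have : P.-negligible (lim_sup_set B).
  apply: negligibleS aeQ => w Bw Qw; apply: noQ; exists w; split=> // m.
  have [t mt Bt] := Bw m I; exists t => // i ni.
  have := Bt (t + i)%N; rewrite /= addKn; apply.
  by apply/imfsetP; exists i => //=; rewrite mem_iota.
move/measure_negligible => P0; move: P_limsup; rewrite P0 ?ltxx//.
by apply: bigcapT_measurable => k; apply: bigcup_measurable.
Qed.

Lemma finite_rank_of_orbit (R : realType) (G : topologicalGroupType)
    (f : G -> R) :
  finite_dimensional (linear_span (orbit_of f : set (G -> R^o))) ->
  exists n (a : 'I_n -> G -> R) (e : 'I_n -> G -> R),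
    forall g y, f (g * y)%g = \sum_i a i g * e i y.
Proof.
move=> [n [e spanE]].
have /choice[a aE] g : exists a : 'I_n -> R,
    forall y, f (g * y)%g = \sum_i a i * e i y.
  have : linear_span (range e) (translate g^-1%g f : G -> R^o).
    rewrite -spanE; exists 1%N, (fun=> 1), (fun=> translate g^-1%g f).
    split=> [_|]; first by exists g^-1%g.
    by rewrite big_ord1 scale1r.
  move=> [m [b [v [ev fE]]]].
  have /choice[k kE] i : exists j, e j = v i by have [j _ <-] := ev i; exists j.
  (* The spanning list [v] may repeat an [e j], so coefficients are collected over each fibre of
     [k]. *)
  exists (fun j => \sum_(i | k i == j) b i) => y.
  have -> : f (g * y)%g = \sum_i b i * v i y.
    have := congr1 (@^~ y) fE; rewrite /translate invgK => ->.
    by rewrite fct_sumE; apply: eq_bigr.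
  rewrite (partition_big k xpredT)//=; apply: eq_bigr => j _.
  by rewrite mulr_suml; apply: eq_bigr => i /eqP <-; rewrite kE.
by exists n, (fun i g => a g i), e => g y; exact: aE.
Qed.

Section ContinuousCocycle.
Variables (R : realType) (G : topologicalGroupType) (f : G -> R).
Variables (d : nat) (x h : 'I_d -> G).
Hypothesis f_cont : continuous f.

Lemma mulg_left_continuous (y : G) : continuous (fun g => (y * g)%g).
Proof.
move=> g; apply: (@continuous2_cvg _ _ _ _ _ _ (fun=> y) id
  (fun a b : G => (a * b)%g)).
- exact: (@mulg_continuous G (y, g)).
- exact: cvg_cst.
- exact: cvg_id.
Qed.

Lemma mulg_right_continuous (y : G) : continuous (fun g => (g * y)%g).
Proof.
move=> g; apply: (@continuous2_cvg _ _ _ _ _ _ id (fun=> y)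
  (fun a b : G => (a * b)%g)).
- exact: (@mulg_continuous G (g, y)).
- exact: cvg_id.
- exact: cvg_cst.
Qed.

Lemma cocycle_continuous a : continuous (fun g => cocycle f x h g 0 a).
Proof.
have -> : (fun g => cocycle f x h g 0 a) = (fun g => \sum_i
    (f (x i * g)%g - f (x i)) * invmx (pairing f x h) i a).
  by apply/funext => g; rewrite mxE; apply: eq_bigr => i _; rewrite mxE.
move=> g; apply: (@cvg_big R _ +%R 0 _ (@add_continuous R)) => i _.
apply: cvgM; last exact: cvg_cst.
apply: cvgB; last exact: cvg_cst.
exact: (cvg_comp _ _ (@mulg_left_continuous (x i) g) (@f_cont _)).
Qed.

Lemma linear_part_continuous j a :
  continuous (fun g => linear_part f x h g j a).
Proof.
have -> : (fun g => linear_part f x h g j a) = (fun g =>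
    cocycle f x h (g * h j)%g 0 a - cocycle f x h g 0 a).
  by apply/funext => g; rewrite !mxE.
move=> g; apply: cvgB; last exact: cocycle_continuous.
exact: (cvg_comp _ _ (@mulg_right_continuous (h j) g) (@cocycle_continuous a _)).
Qed.

Lemma coordinate_continuous i :
  continuous (coordinate (cocycle f x h) (linear_part f x h) i).
Proof.
case: i => [[j|] a]; [exact: linear_part_continuous|exact: cocycle_continuous].
Qed.

End ContinuousCocycle.

(** The closure of [H] is a closed subgroup whose complement lies in the null set [N], so
    adaptedness applies. *)
Lemma subgroup_of_full_set_dense (R : realType) (G : topologicalGroupType)
    (mu : probability (borel G) R) (N H : set G) :
  adapted mu -> open N -> mu N = 0 -> subgroup H -> ~` N `<=` H ->
  closure H = [set: G].
Proof.
move=> mu_adapted N_open N0 H_sub NH; apply: mu_adapted.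
- exact: closed_closure.
- exact: subgroup_closure.
have mH : measurable (closure H : set (borel G)).
  rewrite -[closure H]setCK; apply: measurableC.
  by apply: sub_sigma_algebra; exact/closed_openC/closed_closure.
have := probability_setC mu (measurableC mH); rewrite setCK => ->.
rewrite (_ : mu (~` closure H) = 0) ?sube0//.
apply/le_anti; rewrite measure_ge0 andbT -N0; apply: le_measure.
- by apply: mem_set; exact: measurableC.
- by apply: mem_set; apply: (@sub_sigma_algebra G setT open).
- move=> z Hz; apply: contrapT => Nz.
  by apply: Hz; apply: subset_closure; exact: NH.
Qed.

Section Walk.
Variables (R : realType) (G : topologicalGroupType) (f : G -> R).
Variables (d : nat) (x h : 'I_d -> G).
Hypothesis pairing_unit : pairing f x h \in unitmx.
Hypothesis incrementE : forall y g,
  increment f y g = (cocycle f x h g *m covector f h y) 0 0.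
Hypothesis unimodular : forall g, `|\det (linear_part f x h g)| = 1.

Let c := cocycle f x h.

(* Up to the unimodular factor [linear_part (word_prod u t)] and the constant
   [pairing], this determinant is that of the increments of [f] over the window. *)
Lemma walk_volume_cvg0 (u : nat -> G) (k : 'I_d -> nat) : (0 < d)%N ->
  (forall i, cvgn (fun t => f (x i * word_prod u t)%g)) ->
  \det (\matrix_j c (word_prod (fun i => u (t + i)%N) (k j))) @[t --> \oo] --> 0.
Proof.
move=> d0 fu; set D := fun t => \det _.
have : \det (\matrix_(j, i) increment f (x i * word_prod u t)%g
    (word_prod (fun i => u (t + i)%N) (k j))) @[t --> \oo] --> (0 : R).
  (* Positivity of [d] matters: the empty determinant is 1. *)
  have <- : \det (0 : 'M[R]_d) = 0.
    by move: d0; clear; case: d => // n _; exact: det0.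
  apply: cvg_det => j i; rewrite mxE.
  have -> : (fun t => (\matrix_(j, i) increment f (x i * word_prod u t)%g
      (word_prod (fun i => u (t + i)%N) (k j))) j i) = (fun t =>
      f (x i * word_prod u (t + k j)%N)%g - f (x i * word_prod u t)%g).
    by apply/funext => t; rewrite mxE /increment -mulgA -word_prodD.
  rewrite -(subrr (lim ((fun t => f (x i * word_prod u t)%g) @ \oo))).
  apply: cvgB; last exact: fu.
  by rewrite (cvg_shiftn (k j) (fun t => f (x i * word_prod u t)%g)); exact: fu.
have N0 : `|\det (pairing f x h)| != 0 by rewrite normr_eq0 -unitfE -unitmxE.
(* The determinant of [linear_part] is known only up to sign, so absolute values are compared. *)
move=> /cvg_norm; rewrite normr0 => E; apply: norm_cvg0.
have -> : (fun t => `|D t|) = (fun t => `|\det (\matrix_(j, i)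
    increment f (x i * word_prod u t)%g
      (word_prod (fun i => u (t + i)%N) (k j)))| / `|\det (pairing f x h)|).
  apply/funext => t; rewrite (increments_translate incrementE) !det_mulmx !normrM.
  by rewrite unimodular mulr1 mulfK.
rewrite -(mul0r (`|\det (pairing f x h)|^-1)).
by apply: cvgM => //; exact: cvg_cst.
Qed.

End Walk.

(** Symmetry of [mu] makes the set of inverses of [N] null as well. With an inverse-closed
    complement, the words in it form a subgroup. *)
Lemma symmetric_full_support (R : realType) (G : topologicalGroupType)
    (mu : probability (borel G) R) (N : set G) :
  symmetric_measure mu -> open N -> mu N = 0 ->
  exists N' : set G, [/\ open N', mu N' = 0, N `<=` N' &
    [set g^-1%g | g in ~` N'] = ~` N'].
Proof.
move=> mu_sym N_open N0.
have NV : [set g^-1%g | g in N] = (fun g : G => g^-1%g) @^-1` N.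
  apply/seteqP; split=> [_ [g Ng <-]|g /= Ng]; first by rewrite /= invgK.
  by exists g^-1%g; rewrite ?invgK.
have NV_open : open ((fun g : G => g^-1%g) @^-1` N).
  by apply: open_comp => // g _; exact: invg_continuous.
have mN : measurable (N : set (borel G)) by exact: sub_sigma_algebra.
exists (N `|` (fun g : G => g^-1%g) @^-1` N); split.
- exact: openU.
- rewrite measureU0//; first exact: sub_sigma_algebra.
  by rewrite -NV; apply: etrans (esym (mu_sym _ mN)) N0.
- by move=> g; left.
apply/seteqP; split=> [_ [g Ng <-]|g Ng].
  by move=> /= [|/=]; rewrite ?invgK => ?; apply: Ng; [right|left].
exists g^-1%g; rewrite ?invgK// => -[|/=]; rewrite ?invgK => ?.
  by apply: Ng; right.
by apply: Ng; left.
Qed.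

Theorem theorem9 (R : realType) (G : topologicalGroupType) (K : set G)
    (mu : probability (borel G) R)
    (d : measure_display) (Omega : measurableType d)
    (P : probability Omega R) (U : nat -> {RV P >-> borel G})
    (f : G -> R)
    (G_lc : locally_compact_group G)
    (K_gen : compact_symmetric_generating_set K)
    (G_amenable : amenable R G)
    (mu_courteous : courteous K mu)
    (U_iid : iid_with_law mu U)
    (f_cont : continuous f)
    (f_cvg : converges_along_random_walks P (random_walk U) f)
    (f_growth : subexponential_growth K f)
    (f_dim : finite_dimensional
               (linear_span (orbit_of f : set (G -> R^o)))) :
  exists c : R, forall x : G, f x = c.
Proof.
have [mu_adapted mu_sym _] := mu_courteous.
have [n [a [e fE]]] := finite_rank_of_orbit f_dim.
(* Both [f (y * g)] and [f y] expand with the same coefficients [a i y], so the kernel has rank at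
   most [n]. *)
have kE y g : increment f y g = \sum_i a i y * (e i g - e i 1%g).
  rewrite /increment -[X in _ - f X]mulg1 !fE -sumrB.
  by apply: eq_bigr => i _; rewrite mulrBr.
have [m [x [h]]] := finite_rank_skeleton (e := fun i g => e i g - e i 1%g) kE.
move=> [pairing_unit incE].
have {}incE y g : increment f y g = (cocycle f x h g *m covector f h y) 0 0.
  exact: incE.
have [m0|m_gt0] := posnP m.
  exists (f 1%g) => g; move: (incE 1%g g); rewrite /increment mul1g => /eqP.
  rewrite mxE big1 ?subr_eq0 => [/eqP//|i _].
  by case: i => i im; exfalso; move: im; rewrite m0.
exfalso.
have unimodular := norm_det_linear_part K_gen f_growth pairing_unit incE.
have cM := cocycleM pairing_unit incE.
have rho1 := linear_part1 pairing_unit.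
have rhoM := linear_partM pairing_unit incE.
have [N0 [N0_open N0_null N0_supp]] :=
  null_off_support (@coordinate_continuous _ _ f _ x h f_cont) mu.
have [N [N_open N_null N0N NV]] :=
  symmetric_full_support mu_sym N0_open N0_null.
pose H := [set g | exists k, set_power (~` N) k g].
have H_dense : closure H = [set: G].
  apply: (subgroup_of_full_set_dense mu_adapted N_open N_null).
    exact: set_power_subgroup.
  by move=> g Ng; exists 1%N; exists 1%g => //; exists g; rewrite ?mul1g.
have spans (L : 'M[R]_m) :
    (forall k g, set_power (~` N) k g -> cocycle f x h g *m L = 0) -> L = 0.
  move=> HL; apply/matrixP => i j; rewrite [RHS]mxE.
  (* The elements whose cocycle is annihilated by column [j] of [L] form a closed set containing the
     dense [H], hence all of [G]; evaluation at [h i] returns [L i j]. *)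
  pose F : set G := (fun g => (cocycle f x h g *m L) 0 j) @^-1` [set 0].
  have F_closed : closed F.
    apply: closed_comp; last exact: closed_eq.
    move=> g _.
    have -> : (fun g => (cocycle f x h g *m L) 0 j) =
        (fun g => \sum_l cocycle f x h g 0 l * L l j).
      by apply/funext => g'; rewrite mxE.
    apply: (@cvg_big R _ +%R 0 _ (@add_continuous R)) => l _.
    by apply: cvgM; [exact: cocycle_continuous|exact: cvg_cst].
  have : closure H `<=` F.
    rewrite closureE; apply: smallest_sub => // g [k gk].
    by rewrite /F/= (HL _ _ gk) mxE.
  rewrite H_dense => /(_ (h i) I); rewrite /F/= cocycle_basis//.
  by rewrite -rowE mxE.
have [v [q [Nv vq]]] := full_word rho1 cM rhoM spans.
(* Lengths of [m] prefixes whose cocycles form a basis. *)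
pose k := fullrankfun vq.
have vk : \det (\matrix_j cocycle f x h (word_prod v (k j))) != 0.
  rewrite -unitfE -unitmxE; have := fullrowsub_unit vq.
  by congr (_ \in unitmx); apply/row_matrixP => j; rewrite row_rowsub !rowK.
have kq j : (k j <= q)%N by rewrite -ltnS.
have [r [r0 stable]] := det_words_stable cM rhoM kq vk.
pose A i := box (coordinate (cocycle f x h) (linear_part f x h))
  (coordinate (cocycle f x h) (linear_part f x h) ^~ (v i)) r.
have mA i : measurable (A i : set (borel G)).
  by apply: sub_sigma_algebra; apply: box_open; exact: coordinate_continuous.
have A_gt0 i : (i < q)%N -> (0 < mu (A i))%E.
  by move=> iq; apply: N0_supp => // /N0N; exact: Nv.
have ae_cvg : {ae P, forall w, forall i : 'I_m,
    cvgn (fun t => f (x i * random_walk U t w)%g)}.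
  by apply: filter_forall => i; exact: f_cvg.
have [w [w_cvg w_rec]] := patterns_recur U_iid mA A_gt0 ae_cvg.
have vol0 := @walk_volume_cvg0 _ _ f _ x h pairing_unit incE unimodular
  (fun i => U i w) (fun j => k j) m_gt0 w_cvg.
have half0 : 0 < `|\det (\matrix_j cocycle f x h (word_prod v (k j)))| / 2.
  by rewrite divr_gt0// normr_gt0.
(* From [t0] on the volume stays below half of its value at [v], yet a matching window starts at
   some [t >= t0] and exceeds that half. *)
have [t0 _ small] := cvgr0_norm_lt _ vol0 _ half0.
have [t t0t At] := w_rec t0.
have := small t t0t; apply/negP; rewrite -leNgt; apply: ltW.
exact: stable At.
Qed.
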